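(* Let $F:\mathbb{R}^n\to\mathbb{R}^n$ be $\sigma$-strongly monotone ($\sigma>0$) and Lipschitz continuous with modulus $\ell_F>0$. Let $K(x)=c(x)+C$ for $x\in\mathbb{R}^n$, where $C\subset\mathbb{R}^n$ is a nonempty closed convex set and $c:\mathbb{R}^n\to\mathbb{R}^n$ is Lipschitz continuous with modulus $\ell_c>0$. Assume that for some $\tau\in(\frac12,1)$, $$2\sigma-\ell_F^2>0\qquad\text{and}\qquad\ell_c\le\Bigl(\sqrt\tau-\tfrac{\sqrt2}{2}\Bigr)\sqrt{2\sigma-\ell_F^2}.$$ Then the QVI $$\text{find }\bar x\in K(\bar x)\text{ such that }\langle F(\bar x),x-\bar x\rangle\ge0\ \text{ for all }x\in K(\bar x)$$ has a unique solution $\bar x$, and from any starting point $(x^0,y^0)\in\mathbb{R}^n\times\mathbb{R}^n$, Algorithm 1 (see context) generates a sequence $\{x^k\}$ converging to $\bar x$, provided the parameters $r_k$ satisfy $$0<r_0\le r_k\le r_{k+1}\le\left(\frac{\frac12-(\sqrt{2\tau}-\tau)}{\frac12+(\sqrt{2\tau}-\tau)}\right)(2\sigma-\ell_F^2)\quad\text{for all }k.$$ Moreover, the sequence $\bigl\{\|x^k-\bar x\|^2+\frac1{r_k^2}\|y^k\|^2\bigr\}$ converges to zero with a global linear rate, i.e. there is $t\in(0,1)$ such that $\|x^{k+1}-\bar x\|^2+\frac1{r_{k+1}^2}\|y^{k+1}\|^2\le t\bigl(\|x^k-\bar x\|^2+\frac1{r_k^2}\|y^k\|^2\bigr)$ for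 all $k\ge 0$.
   Context: $\|\cdot\|$, $\langle\cdot,\cdot\rangle$ are Euclidean. $F$ is $\sigma$-strongly monotone if $\langle F(x)-F(y),x-y\rangle\ge\sigma\|x-y\|^2$ for all $x,y$. VI$(G,D)$ is the problem: find $x\in D$ with $\langle G(x),z-x\rangle\ge0$ for all $z\in D$. Algorithm 1 (progressive decoupling for the QVI): given $x^0,y^0\in\mathbb{R}^n$, for $k=0,1,2,\dots$ choose $r_k>0$, set $K^k=K(x^k-\frac1{r_k}y^k)$, let $\hat x^k$ be a solution of VI$(G_k,K^k)$ with $G_k(u)=F(u)+r_ku-y^k-r_kx^k$, and set $$x^{k+1}=\tfrac12\Bigl(\hat x^k+x^k-\tfrac1{r_k}y^k\Bigr),\qquad y^{k+1}=y^k-\tfrac{r_k}{2}\Bigl(\hat x^k-x^k+\tfrac1{r_k}y^k\Bigr).$$ (The stopping test is disregarded when discussing convergence.) *)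

(* Defs.v *)
From HB Require Import structures.
From mathcomp Require Import all_boot all_order all_algebra.
From mathcomp Require Import all_classical all_reals all_analysis.

Set Implicit Arguments.
Unset Strict Implicit.
Unset Printing Implicit Defensive.

Import Order.TTheory GRing.Theory Num.Theory.
Import numFieldNormedType.Exports.

Local Open Scope classical_set_scope.
Local Open Scope ring_scope.

(* The library norm `|u| on row vectors is the sup norm, so the Euclidean inner
   product and norm are introduced here.  Both norms induce the same topology,
   so the library notions of closed sets and of limits apply unchanged. *)
Definition dotp (R : realType) (n : nat) (u v : 'rV[R]_n) : R :=
  \sum_(i < n) u ord0 i * v ord0 i.

Definition enorm (R : realType) (n : nat) (u : 'rV[R]_n) : R :=
  Num.sqrt (dotp u u).

Definition strongly_monotone (R : realType) (n : nat) (sigma : R)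
    (F : 'rV[R]_n -> 'rV[R]_n) : Prop :=
  forall x y, sigma * enorm (x - y) ^+ 2 <= dotp (F x - F y) (x - y).

Definition lipschitz_modulus (R : realType) (n : nat) (l : R)
    (F : 'rV[R]_n -> 'rV[R]_n) : Prop :=
  forall x y, enorm (F x - F y) <= l * enorm (x - y).

Definition moving_set (R : realType) (n : nat)
    (c : 'rV[R]_n -> 'rV[R]_n) (C : set 'rV[R]_n) (x : 'rV[R]_n) :
    set 'rV[R]_n :=
  [set c x + z | z in C].

Definition VI_solution (R : realType) (n : nat)
    (G : 'rV[R]_n -> 'rV[R]_n) (D : set 'rV[R]_n) (x : 'rV[R]_n) : Prop :=
  D x /\ forall z, D z -> 0 <= dotp (G x) (z - x).

Definition QVI_solution (R : realType) (n : nat)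
    (F : 'rV[R]_n -> 'rV[R]_n) (K : 'rV[R]_n -> set 'rV[R]_n)
    (x : 'rV[R]_n) : Prop :=
  K x x /\ forall z, K x z -> 0 <= dotp (F x) (z - x).

(* One iteration, from (x, y) to (x', y'), with parameter r; the existential
   xh is the chosen solution of the subproblem. *)
Definition pd_step (R : realType) (n : nat)
    (F : 'rV[R]_n -> 'rV[R]_n) (K : 'rV[R]_n -> set 'rV[R]_n) (r : R)
    (x y x' y' : 'rV[R]_n) : Prop :=
  exists xh : 'rV[R]_n,
    [/\ VI_solution (fun u => F u + r *: u - y - r *: x)
          (K (x - r^-1 *: y)) xh,
        x' = 2^-1 *: (xh + x - r^-1 *: y) &
        y' = y - (r / 2) *: (xh - x + r^-1 *: y)].

(* The sequences x, y form an infinite run of the progressive decoupling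
   algorithm (no stopping test) with parameters r, started at (x0, y0). *)
Definition pd_run (R : realType) (n : nat)
    (F : 'rV[R]_n -> 'rV[R]_n) (K : 'rV[R]_n -> set 'rV[R]_n) (r : nat -> R)
    (x0 y0 : 'rV[R]_n) (x y : nat -> 'rV[R]_n) : Prop :=
  [/\ x 0%N = x0, y 0%N = y0 &
      forall k, 0 < r k /\ pd_step F K (r k) (x k) (y k) (x k.+1) (y k.+1)].

Definition pd_merit (R : realType) (n : nat) (xb : 'rV[R]_n) (r : nat -> R)
    (x y : nat -> 'rV[R]_n) (k : nat) : R :=
  enorm (x k - xb) ^+ 2 + (r k ^+ 2)^-1 * enorm (y k) ^+ 2.

(* Main.v *)
Require Import Defs.
From HB Require Import structures.
From mathcomp Require Import all_boot all_order all_algebra.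
From mathcomp Require Import all_classical all_reals all_analysis.
From mathcomp Require Import ring lra.

Set Implicit Arguments.
Unset Strict Implicit.
Unset Printing Implicit Defensive.

Import Order.TTheory GRing.Theory Num.Theory.
Import numFieldNormedType.Exports.

Local Open Scope classical_set_scope.
Local Open Scope ring_scope.

(** The fixed point of the algorithm is (xb, 0), where xb solves the QVI.  Fix
    one iteration with parameter r, let xh be the solution of its subproblem, and
    put e = x - xb, v = y / r, h = xh - xb.  The subproblem is the VI for
    u |-> F u + r (u - p) over K(q), where
    p = x + y / r = xb + e + v and q = x - y / r = xb + e - v, and the update
    reads x' - xb = (e + (h - v)) / 2 and y' / r = (e - (h - v)) / 2.  By the
    parallelogram law the new merit, measured with the old r, equals
    (|e|^2 + |h - v|^2) / 2, and passing to a larger r only decreases it.  So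
    everything rests on a bound for h.

    Put m = 2 sigma - lF^2.  Two VI solutions over translates of the same convex
    set can be tested against each other after translating back; strong
    monotonicity and Young's inequality turn this into
    m |h|^2 <= |d|^2 + 2 r <p1 - p2 - h, h - d>, where d is the difference of
    the translations (prox_VI_perturb).
    - With r = 0 it says that q |-> solution of VI(F, K(q)) has Lipschitz
      modulus lc / sqrt m < 1.  Its fixed points are the solutions of the QVI,
      whence existence and uniqueness (QVI_exists_unique).
    - With r > 0 and the second solution taken to be xb, put w = sqrt (2 tau)
      and a = (w - 1)^2 / 2 = 1/2 - (sqrt (2 tau) - tau).  The hypotheses say
      lc^2 <= a m and r <= a m / (1 - a), and they yield
      |h|^2 <= a (|e - v|^2 + |e + v|^2) = (w - 1)^2 (|e|^2 + |v|^2)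
      (prox_VI_estimate).  Then (e, h - v) differs from (e, - v) by (0, h), so
      its length is at most 1 + (w - 1) = w times that of (e, v), and the merit
      is multiplied by at most w^2 / 2 = tau (pd_step_contract).

    Solvability of the subproblems is the classical theorem on strongly monotone
    Lipschitz VIs (VI_exists): u |-> P (u - g G u) is a contraction for small
    g > 0, where P is the Euclidean projection.  All estimates are
    carried out on squared norms, where Young's inequality replaces both the
    Cauchy-Schwarz and the triangle inequality. *)

(** * The Euclidean inner product *)

Section EuclideanStructure.
Variables (R : realType) (n : nat).
Implicit Types (u v w : 'rV[R]_n) (a : R).

Lemma dotpC u v : dotp u v = dotp v u.
Proof. by apply: eq_bigr => i _; rewrite mulrC. Qed.

Lemma dotpDl u v w : dotp (u + v) w = dotp u w + dotp v w.
Proof. by rewrite -big_split; apply: eq_bigr => i _; rewrite mxE mulrDl. Qed.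

Lemma dotpZl a u v : dotp (a *: u) v = a * dotp u v.
Proof. by rewrite mulr_sumr; apply: eq_bigr => i _; rewrite mxE mulrA. Qed.

Lemma dotpNl u v : dotp (- u) v = - dotp u v.
Proof. by rewrite -scaleN1r dotpZl mulN1r. Qed.

Lemma dotpDr u v w : dotp w (u + v) = dotp w u + dotp w v.
Proof. by rewrite dotpC dotpDl !(dotpC w). Qed.

Lemma dotpZr a u v : dotp u (a *: v) = a * dotp u v.
Proof. by rewrite dotpC dotpZl dotpC. Qed.

Lemma dotpNr u v : dotp u (- v) = - dotp u v.
Proof. by rewrite dotpC dotpNl dotpC. Qed.

Definition dotpE := (dotpDl, dotpDr, dotpNl, dotpNr, dotpZl, dotpZr).

Lemma dotp_sqrD u v :
  dotp (u + v) (u + v) = dotp u u + 2 * dotp u v + dotp v v.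
Proof. by rewrite !dotpE (dotpC v u); ring. Qed.

Lemma dotp_sqrB u v :
  dotp (u - v) (u - v) = dotp u u - 2 * dotp u v + dotp v v.
Proof. by rewrite dotp_sqrD !dotpE; ring. Qed.

(** Since the left side is nonnegative, the cross term 2 <w - u, u - v>, which
    is the one in prox_VI_perturb, is at most |w|^2 + |v|^2 - |u|^2. *)
Lemma dotp_three_point u v w :
  dotp (w - u + v) (w - u + v) =
  dotp w w + dotp v v - dotp u u - 2 * dotp (w - u) (u - v).
Proof. by rewrite !dotpE (dotpC u w) (dotpC v w) (dotpC v u); ring. Qed.

Lemma dotp_ge0 u : 0 <= dotp u u.
Proof. by apply: sumr_ge0 => i _; rewrite -expr2 sqr_ge0. Qed.

Lemma enorm_sqr u : enorm u ^+ 2 = dotp u u.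
Proof. by rewrite sqr_sqrtr ?dotp_ge0. Qed.

Lemma enorm_ge0 u : 0 <= enorm u.
Proof. exact: sqrtr_ge0. Qed.

Lemma dotp_young a u v : 0 < a ->
  2 * dotp u v <= a^-1 * dotp u u + a * dotp v v.
Proof.
move=> a0; have := dotp_ge0 (u - a *: v).
rewrite dotp_sqrB dotpZl !dotpZr => H.
rewrite -(ler_pM2l a0) mulrDr mulVKf ?gt_eqF//; lra.
Qed.

(** Together with dotp_le_norm_sqr: the Euclidean norm is equivalent to the sup
    norm of row vectors. *)
Lemma norm_sqr_le_dotp u : `|u| ^+ 2 <= dotp u u.
Proof.
have [->|u0] := eqVneq u 0; first by rewrite normr0 expr0n /= dotp_ge0.
have /mx_norm_neq0[[i j] /= uij] : mx_norm u != 0.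
  by rewrite -[mx_norm u]/`|u| normr_eq0.
rewrite -[`|u|]/(mx_norm u) uij (ord1 i) real_normK ?num_real//.
rewrite /dotp (bigD1 j)//= -expr2 lerDl; apply: sumr_ge0 => k _.
by rewrite -expr2 sqr_ge0.
Qed.

Lemma dotp_le_norm_sqr u : dotp u u <= n%:R * `|u| ^+ 2.
Proof.
have -> : n%:R * `|u| ^+ 2 = \sum_(i < n) `|u| ^+ 2.
  by rewrite sumr_const card_ord mulr_natl.
apply: ler_sum => i _; rewrite -expr2 -real_normK ?num_real//.
rewrite ler_sqr ?nnegrE//.
rewrite -[leRHS]/(mx_norm u) mx_normrE.
exact: (le_bigmax _ (fun ij => `|u ij.1 ij.2|) (ord0, i)).
Qed.

Lemma dotp_eq0 u : dotp u u <= 0 -> u = 0.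
Proof.
move=> u0; apply/eqP; rewrite -normr_eq0 -sqrf_eq0; apply/eqP/le_anti.
by rewrite sqr_ge0 (le_trans (norm_sqr_le_dotp u)).
Qed.

(** A Euclidean contraction need not contract the sup norm for which the space
    of row vectors is normed, but a high enough iterate does, because the two
    norms are equivalent.  The fixed point of that iterate is fixed by T, since
    T commutes with it and the iterate has at most one fixed point. *)
Lemma dotp_contraction_fixpoint (T : 'rV[R]_n -> 'rV[R]_n) (q : R) :
  0 <= q -> q < 1 ->
  (forall u v, dotp (T u - T v) (T u - T v) <= q * dotp (u - v) (u - v)) ->
  exists p, T p = p.
Proof.
move=> q0 q1 Tq.
have TNq N u v : dotp (iter N T u - iter N T v) (iter N T u - iter N T v)
    <= q ^+ N * dotp (u - v) (u - v).
  elim: N => [|N IH]; first by rewrite expr0 mul1r.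
  by rewrite exprS -mulrA (le_trans (Tq _ _))// ler_wpM2l.
(* The dimension is replaced by n.+1 so that q ^+ N < 1 also when n = 0. *)
have [N NE] : exists N, q ^+ N * n.+1%:R <= 4^-1.
  have q1' : `|q| < 1 by rewrite ger0_norm.
  have lim0 : q ^+ N * n.+1%:R @[N --> \oo] --> (0 : R).
    rewrite -(mul0r n.+1%:R).
    by apply: cvgM; [exact: cvg_expr|exact: cvg_cst].
  have e0 : (0 : R) < 4^-1 by rewrite invr_gt0.
  have /cvgr0Pnorm_le /(_ _ e0) [N _ HN] := lim0.
  by exists N; rewrite (le_trans (ler_norm _))//; apply: HN => /=.
pose X : completeNormedModType R :=
  HB.pack 'rV[R]_n (Uniform_isComplete.Build 'rV[R]_n (@cauchy_cvg _)).
pose S : {fun [set: X] >-> [set: X]} := [fun of totalfun (iter N T : X -> X)].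
have ctr : is_contraction S.
  exists (2^-1)%:nng; split => /=; first lra.
  case=> u v _ /=.
  rewrite -ler_sqr ?nnegrE ?mulr_ge0// (le_trans (norm_sqr_le_dotp _))//.
  rewrite (le_trans (TNq _ _ _))// exprMn.
  have -> : 2^-1 ^+ 2 = 4^-1 :> R by field.
  rewrite (le_trans (ler_wpM2l _ (dotp_le_norm_sqr _))) ?exprn_ge0//.
  rewrite mulrA ler_wpM2r ?sqr_ge0// (le_trans _ NE)//.
  by rewrite ler_wpM2l ?exprn_ge0// ler_nat.
have [p _ pE] := banach_fixed_point ctr closedT (ex_intro _ 0 I).
exists p; apply/eqP; rewrite -subr_eq0; apply/eqP/dotp_eq0.
have := TNq N (T p) p; rewrite -iterSr iterS.
have -> : iter N T p = p by rewrite {2}pE.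
have : q ^+ N <= 4^-1.
  by rewrite (le_trans _ NE)// ler_peMr ?exprn_ge0// ler1n.
have := dotp_ge0 (T p - p); nra.
Qed.

(** * Existence for strongly monotone variational inequalities *)

Lemma dotp_self_continuous (p : 'rV[R]_n) :
  continuous (fun u : 'rV[R]_n => dotp (u - p) (u - p)).
Proof.
apply: continuous_big; first exact: add_continuous.
have coordB i : continuous (fun u : 'rV[R]_n => (u - p) ord0 i).
  under eq_fun do rewrite !mxE.
  move=> u; apply: (@cvgB _ _ _ (nbhs u)); last exact: cvg_cst.
  exact: coord_continuous.
by move=> i _ u; apply: (@cvgM _ _ (nbhs u)); exact: coordB.
Qed.

(** The projection of p onto C, characterised as a VI solution so that it is
    covered by the pairing argument VI_solution_pair.  The distance to p attains
    its minimum on C because only a compact part of C matters, and moving from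
    the minimiser z towards w inside C cannot decrease it. *)
Lemma projection_exists (C : set 'rV[R]_n) (p : 'rV[R]_n) :
  C !=set0 -> closed C -> convex_set C ->
  exists z, VI_solution (fun u => u - p) C z.
Proof.
move=> [z0 Cz0] Ccl Cco; pose f (u : 'rV[R]_n) := dotp (u - p) (u - p).
have fc : continuous f := @dotp_self_continuous p.
pose A := C `&` f @^-1` [set s | s <= f z0].
have A0 : A !=set0 by exists z0; split => //=.
have Acl : closed A.
  apply: closedI => //.
  by apply: (continuous_closedP f).1 => //; exact: closed_le.
have Abd : bounded_set A.
  exists (`|p| + f z0 + 1); split; first exact: num_real.
  move=> M ltM u [_ /= fu]; rewrite (le_trans _ (ltW ltM))//.
  have : `|u| <= `|u - p| + `|p| by rewrite -{1}(subrK p u) ler_normD.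
  have := le_trans (norm_sqr_le_dotp (u - p)) fu.
  have := sqr_ge0 (`|u - p| - 1); nra.
have Aco : compact A by exact: bounded_closed_compact.
have [z /set_mem[Cz fz] zmin] := EVT_min_rV A0 Aco (continuous_subspaceT fc).
exists z; split=> // w Cw.
have zminC u : C u -> f z <= f u.
  move=> Cu; have [fu|fu] := leP (f u) (f z0); first by apply/zmin/mem_set.
  by rewrite (le_trans fz)// ltW.
rewrite leNgt; apply/negP => neg.
have D0 := dotp_ge0 (w - z).
set s := dotp (z - p) (w - z) in neg; set D := dotp (w - z) (w - z) in D0.
(* The change 2 t s + t^2 D of the squared distance is negative for this t. *)
pose t := - s / (D - s).
have Ds : 0 < D - s by lra.
have t0 : 0 < t by rewrite divr_gt0//; lra.
have t1 : t <= 1 by rewrite ler_pdivrMr//; lra.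
have tE : t * (D - s) = - s by rewrite divfK ?gt_eqF.
have Ct : C (z + t *: (w - z)).
  have /set_mem := Cco w z (Itv01 (ltW t0) t1) (mem_set Cw) (mem_set Cz).
  congr C; rewrite /conv/= -[unstable.onem t]/(1 - t).
  by rewrite scalerBl scalerBr scale1r addrCA.
have := zminC _ Ct; rewrite /f.
have -> : z + t *: (w - z) - p = (z - p) + t *: (w - z) by rewrite addrAC.
rewrite (dotp_sqrD (z - p)) dotpZl !dotpZr -/s -/D; nra.
Qed.

(** Each solution is an admissible test point in the other problem. *)
Lemma VI_solution_pair (G1 G2 : 'rV[R]_n -> 'rV[R]_n) (D : set 'rV[R]_n) u1 u2 :
  VI_solution G1 D u1 -> VI_solution G2 D u2 ->
  dotp (G1 u1 - G2 u2) (u1 - u2) <= 0.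
Proof.
move=> [D1 H1] [D2 H2]; have := H1 _ D2; have := H2 _ D1.
by rewrite !dotpE; lra.
Qed.

(** The solutions are the fixed points of u |-> P (u - g G u), and with
    g = s / L the squared contraction constant is 1 - g s. *)
Lemma VI_exists (C : set 'rV[R]_n) (G : 'rV[R]_n -> 'rV[R]_n) (s L : R) :
  C !=set0 -> closed C -> convex_set C -> 0 < s -> 0 < L ->
  (forall u v, s * dotp (u - v) (u - v) <= dotp (G u - G v) (u - v)) ->
  (forall u v, dotp (G u - G v) (G u - G v) <= L * dotp (u - v) (u - v)) ->
  exists u, VI_solution G C u.
Proof.
move=> C0 Ccl Cco s0 L0 Gmono Glip.
have [P PP] := choice (fun p => projection_exists p C0 Ccl Cco).
have Pne p1 p2 : dotp (P p1 - P p2) (P p1 - P p2) <= dotp (p1 - p2) (p1 - p2).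
  have := VI_solution_pair (PP p1) (PP p2).
  have := dotp_young (p1 - p2) (P p1 - P p2) (ltr01 : 0 < 1 :> R).
  by rewrite invr1 !dotpE; lra.
pose g := s / L.
have gL : g * L = s by rewrite divfK ?gt_eqF.
have g0 : 0 < g by rewrite divr_gt0.
(* In dimension 0 nothing forces s ^+ 2 <= L, hence the maximum with 0. *)
pose q := Num.max 0 (1 - g * s).
have q0 : 0 <= q by rewrite le_max lexx.
have q1 : q < 1 by rewrite gt_max ltr01/= ltrBlDr ltrDl mulr_gt0.
have [|u uE] := @dotp_contraction_fixpoint (fun u => P (u - g *: G u)) q q0 q1.
  move=> u v; apply: le_trans (Pne _ _) _.
  have -> : u - g *: G u - (v - g *: G v) = (u - v) - g *: (G u - G v).
    rewrite scalerBr !opprB addrACA [RHS]addrACA.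
    by congr (_ + _); rewrite addrC.
  apply: (@le_trans _ _ ((1 - g * s) * dotp (u - v) (u - v))); last first.
    by rewrite ler_wpM2r ?dotp_ge0// le_max lexx orbT.
  have := Gmono u v; have := Glip u v.
  rewrite (dotp_sqrB (u - v)) dotpZl !dotpZr (dotpC (u - v) (G u - G v)).
  set gg := dotp (G u - G v) _; set dd := dotp (u - v) _; set gd := dotp _ _.
  move=> Hlip Hmono.
  have : g * (g * gg) <= g * s * dd.
    by rewrite -mulrA ler_wpM2l ?(ltW g0)// -gL -mulrA ler_wpM2l// ltW.
  have : g * (s * dd) <= g * gd by rewrite ler_wpM2l// ltW.
  lra.
exists u; have [CP HP] := PP (u - g *: G u); rewrite uE in CP HP.
split=> // w Cw; have := HP _ Cw.
by rewrite opprB addrC subrK dotpZl pmulr_rge0.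
Qed.

(** This moves every problem onto the fixed set C, where solutions belonging to
    different parameters can be compared. *)
Lemma VI_translate (c : 'rV[R]_n -> 'rV[R]_n) (C : set 'rV[R]_n)
    (G : 'rV[R]_n -> 'rV[R]_n) q u :
  VI_solution G (moving_set c C q) u <->
  VI_solution (fun z => G (c q + z)) C (u - c q).
Proof.
split=> -[Ku Hu]; split.
- by case: Ku => z Cz <-; rewrite addrC addKr.
- move=> w Cw; rewrite addrC subrK opprB addrA (addrC w).
  by apply: Hu; exists w.
- by exists (u - c q) => //; rewrite addrC subrK.
- move=> _ [w Cw <-]; have := Hu _ Cw.
  by rewrite (addrC (c q)) subrK opprB addrA (addrC w).
Qed.

Lemma VI_moving_exists (c : 'rV[R]_n -> 'rV[R]_n) (C : set 'rV[R]_n)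
    (G : 'rV[R]_n -> 'rV[R]_n) (s L : R) q :
  C !=set0 -> closed C -> convex_set C -> 0 < s -> 0 < L ->
  (forall u v, s * dotp (u - v) (u - v) <= dotp (G u - G v) (u - v)) ->
  (forall u v, dotp (G u - G v) (G u - G v) <= L * dotp (u - v) (u - v)) ->
  exists u, VI_solution G (moving_set c C q) u.
Proof.
move=> C0 Ccl Cco s0 L0 Gmono Glip.
have trE u v : c q + u - (c q + v) = u - v by rewrite (addrC (c q) u) addrKA.
have [|u v|z Hz] := @VI_exists C (fun z => G (c q + z)) s L C0 Ccl Cco s0 L0.
- by move=> u v; rewrite -(trE u v).
- by rewrite -(trE u v).
by exists (c q + z); apply/VI_translate; rewrite addrC addKr.
Qed.

(** * Sensitivity of the subproblems *)

Section Perturbation.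
Variables (F c : 'rV[R]_n -> 'rV[R]_n) (C : set 'rV[R]_n) (sigma lF lc : R).
Hypotheses (sigma_gt0 : 0 < sigma) (F_mono : strongly_monotone sigma F)
  (lF_gt0 : 0 < lF) (F_lip : lipschitz_modulus lF F).
Hypotheses (C_neq0 : C !=set0) (C_closed : closed C) (C_convex : convex_set C).
Hypothesis (c_lip : lipschitz_modulus lc c).

(** Up to the shift in pd_mapE, the map of the subproblem; r = 0 gives F. *)
Definition prox_map (r : R) (p u : 'rV[R]_n) := F u + r *: (u - p).

Lemma strongly_monotone_dotp u v :
  sigma * dotp (u - v) (u - v) <= dotp (F u - F v) (u - v).
Proof. by rewrite -enorm_sqr. Qed.

Lemma lipschitz_modulus_dotp (l : R) (G : 'rV[R]_n -> 'rV[R]_n) u v :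
  lipschitz_modulus l G ->
  dotp (G u - G v) (G u - G v) <= l ^+ 2 * dotp (u - v) (u - v).
Proof.
move=> /(_ u v) H; rewrite -!enorm_sqr -exprMn ler_sqr ?nnegrE ?enorm_ge0//.
by rewrite (le_trans _ H) ?enorm_ge0.
Qed.

Lemma prox_VI_exists r p q : 0 <= r ->
  exists u, VI_solution (prox_map r p) (moving_set c C q) u.
Proof.
move=> r0; pose L := 2 * lF ^+ 2 + 2 * r ^+ 2.
have L0 : 0 < L.
  by rewrite ltr_pwDl ?mulr_gt0 ?exprn_gt0// mulr_ge0// sqr_ge0.
have dE u v : prox_map r p u - prox_map r p v = (F u - F v) + r *: (u - v).
  rewrite /prox_map opprD addrACA -scalerBr; congr (_ + _ *: _).
  by rewrite opprB addrA subrK.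
apply: (@VI_moving_exists _ _ _ sigma L) => // u v; rewrite dE.
- rewrite (dotpDl (F u - F v)) dotpZl.
  rewrite (le_trans (strongly_monotone_dotp u v))// lerDl.
  by rewrite mulr_ge0 ?dotp_ge0.
- have := lipschitz_modulus_dotp u v F_lip.
  have := dotp_young (F u - F v) (r *: (u - v)) (ltr01 : 0 < 1 :> R).
  rewrite invr1 (dotp_sqrD (F u - F v)) !(dotpZl, dotpZr) /L; lra.
Qed.

(** Pairing the two translated problems tests with h - d, where h and d are the
    differences of the solutions and of the translations.  Monotonicity bounds
    <F u1 - F u2, h> below by sigma |h|^2, and Young's inequality bounds
    2 <F u1 - F u2, d> by lF^2 |h|^2 + |d|^2. *)
Lemma prox_VI_perturb r p1 p2 q1 q2 u1 u2 :
  VI_solution (prox_map r p1) (moving_set c C q1) u1 ->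
  VI_solution (prox_map r p2) (moving_set c C q2) u2 ->
  (2 * sigma - lF ^+ 2) * dotp (u1 - u2) (u1 - u2) <=
    dotp (c q1 - c q2) (c q1 - c q2) +
    2 * r * dotp (p1 - p2 - (u1 - u2)) ((u1 - u2) - (c q1 - c q2)).
Proof.
move=> /VI_translate H1 /VI_translate H2.
set h := u1 - u2; set d := c q1 - c q2.
have := VI_solution_pair H1 H2; rewrite !(addrC (c _)) !subrK.
have -> : u1 - c q1 - (u2 - c q2) = h - d.
  by rewrite !opprB addrACA [RHS]addrACA [- c q1 + _]addrC.
have -> : prox_map r p1 u1 - prox_map r p2 u2 =
    (F u1 - F u2) - r *: (p1 - p2 - h).
  rewrite /prox_map opprD addrACA -scalerBr -scalerN; congr (_ + _ *: _).
  by rewrite /h !opprB addrACA [RHS]addrACA; congr (_ + _); rewrite addrC.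
have := strongly_monotone_dotp u1 u2.
have := lipschitz_modulus_dotp u1 u2 F_lip.
have := dotp_young (F u1 - F u2) d (ltr01 : 0 < 1 :> R).
rewrite -/h invr1; set f := F u1 - F u2; set A := p1 - p2 - h.
rewrite dotpDl dotpDr dotpNr dotpNl dotpZl; lra.
Qed.

(** Young's inequality gives 2 sigma |u - v|^2 <= (lF^2 + 1) |u - v|^2.  Two
    distinct points are needed: in dimension 0 sigma is unrestricted. *)
Lemma modulus_le1 u v : u != v -> 2 * sigma - lF ^+ 2 <= 1.
Proof.
move=> uv; have := strongly_monotone_dotp u v.
have := lipschitz_modulus_dotp u v F_lip.
have := dotp_young (F u - F v) (u - v) (ltr01 : 0 < 1 :> R).
have : 0 < dotp (u - v) (u - v).
  rewrite lt0r dotp_ge0 andbT; apply: contra uv => /eqP uv0.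
  by rewrite -subr_eq0; apply/eqP/dotp_eq0; rewrite uv0.
rewrite invr1; set D := dotp (u - v) (u - v) => D0 H1 H2 H3.
rewrite -(ler_pM2r D0); lra.
Qed.

Hypothesis lc_lt : lc ^+ 2 < 2 * sigma - lF ^+ 2.

Lemma VI_solution_lipschitz q1 q2 u1 u2 :
  VI_solution F (moving_set c C q1) u1 ->
  VI_solution F (moving_set c C q2) u2 ->
  (2 * sigma - lF ^+ 2) * dotp (u1 - u2) (u1 - u2) <=
    lc ^+ 2 * dotp (q1 - q2) (q1 - q2).
Proof.
have F0 : F = prox_map 0 0.
  by apply/funext => u; rewrite /prox_map scale0r addr0.
rewrite {1 2}F0 => H1 H2; have := prox_VI_perturb H1 H2.
have := lipschitz_modulus_dotp q1 q2 c_lip; lra.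
Qed.

(** QVI solutions are the fixed points of the solution map q |-> VI(F, K(q)),
    which is a contraction by VI_solution_lipschitz. *)
Lemma QVI_exists_unique : exists xb, QVI_solution F (moving_set c C) xb /\
  forall z, QVI_solution F (moving_set c C) z -> z = xb.
Proof.
have m0 : 0 < 2 * sigma - lF ^+ 2 by rewrite (le_lt_trans _ lc_lt) ?sqr_ge0.
have /choice[S HS] : forall q, exists u, VI_solution F (moving_set c C q) u.
  move=> q; have [u Hu] := prox_VI_exists 0 q (lexx 0).
  exists u; suff -> : F = prox_map 0 0 by [].
  by apply/funext => v; rewrite /prox_map scale0r addr0.
have [|||xb xbE] := @dotp_contraction_fixpoint S
    (lc ^+ 2 / (2 * sigma - lF ^+ 2)).
- by rewrite divr_ge0 ?sqr_ge0// ltW.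
- by rewrite ltr_pdivrMr// mul1r.
- move=> u v; rewrite mulrAC ler_pdivlMr// mulrC.
  exact: VI_solution_lipschitz.
have xbP : QVI_solution F (moving_set c C) xb by have := HS xb; rewrite xbE.
exists xb; split=> // z zP; apply/eqP; rewrite -subr_eq0; apply/eqP/dotp_eq0.
have := VI_solution_lipschitz zP xbP.
by rewrite -subr_le0 -mulrBl pmulr_rle0 // subr_gt0.
Qed.

End Perturbation.

(** * One step of the algorithm *)

Section ProgressiveDecoupling.
Variables (F c : 'rV[R]_n -> 'rV[R]_n) (C : set 'rV[R]_n) (sigma lF lc : R).
Hypotheses (F_mono : strongly_monotone sigma F)
  (F_lip : lipschitz_modulus lF F).
Hypothesis (c_lip : lipschitz_modulus lc c).

Let m := 2 * sigma - lF ^+ 2.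
Variables (xb : 'rV[R]_n) (w : R).
Hypotheses (m_gt0 : 0 < m) (xbP : QVI_solution F (moving_set c C) xb).
Let a := (w - 1) ^+ 2 / 2.
Hypotheses (w_gt1 : 1 < w) (lc_le : lc ^+ 2 <= a * m).

Lemma pd_mapE (r : R) x y : 0 < r ->
  (fun u => F u + r *: u - y - r *: x) = prox_map F r (x + r^-1 *: y).
Proof.
move=> r0; apply/funext => u; rewrite /prox_map.
rewrite scalerBr scalerDr scalerA mulfV ?gt_eqF// scale1r.
by rewrite opprD !addrA addrAC.
Qed.

(** Writing the cross term of prox_VI_perturb by the three-point identity and
    dropping a square leaves (m + r) |h|^2 <= (1 + r) |d|^2 + r |e + v|^2.  The
    bound on lc and m <= 1 make the first term at most (m + r) a |e - v|^2, and
    the bound on r makes the second at most (m + r) a |e + v|^2. *)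
Lemma prox_VI_estimate (r : R) e v xh : 0 < r -> r * (1 - a) <= a * m ->
  VI_solution (prox_map F r (xb + e + v)) (moving_set c C (xb + e - v)) xh ->
  dotp (xh - xb) (xh - xb) <= (w - 1) ^+ 2 * (dotp e e + dotp v v).
Proof.
move=> r0 ra Hxh.
have a0 : 0 < a by rewrite divr_gt0 ?exprn_gt0// subr_gt0.
have ->: (w - 1) ^+ 2 * (dotp e e + dotp v v) =
    a * (dotp (e + v) (e + v) + dotp (e - v) (e - v)).
  by rewrite dotp_sqrD dotp_sqrB /a; field.
have [->|xhxb] := eqVneq xh xb.
  rewrite subrr -[X in dotp X _](scale0r (0 : 'rV[R]_n)) dotpZl mul0r.
  by rewrite mulr_ge0 ?addr_ge0 ?dotp_ge0// ltW.
have m1 : m <= 1 := modulus_le1 F_mono F_lip xhxb.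
have Hxb : VI_solution (prox_map F r xb) (moving_set c C xb) xb.
  case: xbP => Kxb Hxb; split=> // z Kz.
  by rewrite /prox_map subrr scaler0 addr0; exact: Hxb.
have := prox_VI_perturb F_mono F_lip Hxh Hxb.
have := lipschitz_modulus_dotp (xb + e - v) xb c_lip.
have -> : xb + e - v - xb = e - v by apply/rowP => i; rewrite !mxE; ring.
have -> : xb + e + v - xb = e + v by apply/rowP => i; rewrite !mxE; ring.
rewrite -/m; set h := xh - xb; set d := c _ - c xb; set A := e + v.
set B := dotp (e - v) (e - v) => Hd H.
have B0 : 0 <= B by exact: dotp_ge0.
have A0 := dotp_ge0 A.
have dB : dotp d d <= a * m * B by rewrite (le_trans Hd)// ler_wpM2r.
have Hm : (m + r) * dotp h h <= (1 + r) * dotp d d + r * dotp A A.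
  have : 0 <= r * dotp (A - h + d) (A - h + d).
    by rewrite mulr_ge0 ?dotp_ge0 ?ltW.
  rewrite dotp_three_point; lra.
have mr : 0 < m + r by rewrite addr_gt0.
rewrite -(ler_pM2l mr) (le_trans Hm)//.
have : (1 + r) * dotp d d <= (m + r) * (a * B).
  have rm : 0 <= r * (1 - m) * (a * B).
    by apply: mulr_ge0; apply: mulr_ge0; rewrite ?subr_ge0 // ltW.
  have : (1 + r) * dotp d d <= (1 + r) * (a * m * B).
    by rewrite ler_pM2l ?addr_gt0.
  lra.
have : r * dotp A A <= (m + r) * (a * dotp A A).
  by rewrite mulrA ler_wpM2r//; lra.
lra.
Qed.

(** By the parallelogram law the left side is (|e|^2 + |h - v|^2) / 2.  Young's
    inequality splits the cross term - 2 <h, v> with weight w - 1, for which the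
    bound (w - 1)^2 (|e|^2 + |v|^2) on |h|^2 leads to the factor
    (w - 1)^2 + 2 (w - 1) + 1 = w^2. *)
Lemma pd_step_contract (r : R) x y x' y' : 0 < r -> r * (1 - a) <= a * m ->
  pd_step F (moving_set c C) r x y x' y' ->
  dotp (x' - xb) (x' - xb) + (r ^+ 2)^-1 * dotp y' y' <=
  w ^+ 2 / 2 * (dotp (x - xb) (x - xb) + (r ^+ 2)^-1 * dotp y y).
Proof.
move=> r0 ra [xh [Hxh -> ->]].
have rn : r != 0 by rewrite gt_eqF.
have [v vE] : exists v, r^-1 *: y = v by eexists.
pose e := x - xb; pose h := xh - xb.
have yE : y = r *: v by rewrite -vE scalerA mulfV// scale1r.
rewrite pd_mapE// vE in Hxh.
have xE : x = xb + e by rewrite addrC subrK.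
have hB : dotp h h <= (w - 1) ^+ 2 * (dotp e e + dotp v v).
  by apply: (prox_VI_estimate r0 ra); rewrite -xE.
rewrite vE.
have -> : 2^-1 *: (xh + x - v) - xb = 2^-1 *: (e + (h - v)).
  by apply/rowP => i; rewrite !mxE; field.
have -> : y - (r / 2) *: (xh - x + v) = (r / 2) *: (e - (h - v)).
  by rewrite yE; apply/rowP => i; rewrite !mxE; field.
rewrite yE !dotpZl !dotpZr -/e.
have -> : (r ^+ 2)^-1 * (r * (r * dotp v v)) = dotp v v by field.
have -> : (r ^+ 2)^-1 * (r / 2 * (r / 2 * dotp (e - (h - v)) (e - (h - v)))) =
    4^-1 * dotp (e - (h - v)) (e - (h - v)) by field.
have w1 : 0 < w - 1 by rewrite subr_gt0.
have := dotp_young (- h) v w1.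
rewrite (dotp_sqrD e) (dotp_sqrB e) (dotp_sqrB h) !dotpNl dotpNr opprK.
have : (w - 1)^-1 * dotp h h <= (w - 1) * (dotp e e + dotp v v).
  by rewrite ler_pdivrMl// mulrA -expr2.
have := mulr_ge0 (ltW w1) (dotp_ge0 e).
lra.
Qed.

End ProgressiveDecoupling.

End EuclideanStructure.

(** * Runs of the algorithm *)

Lemma linear_rate_cvg0 (R : realType) (t : R) (u : nat -> R) :
  0 <= t -> t < 1 -> (forall k, 0 <= u k) -> (forall k, u k.+1 <= t * u k) ->
  u k @[k --> \oo] --> (0 : R).
Proof.
move=> t0 t1 u0 ut.
have uk k : u k <= t ^+ k * u 0%N.
  elim: k => [|k IH]; first by rewrite expr0 mul1r.
  by rewrite exprS -mulrA (le_trans (ut k))// ler_wpM2l.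
apply: (@squeeze_cvgr _ _ _ _ (fun=> 0) (fun k => t ^+ k * u 0%N)).
- by apply: nearW => k; rewrite u0 uk.
- exact: cvg_cst.
- rewrite -(mul0r (u 0%N)); apply: cvgM; last exact: cvg_cst.
  by apply: cvg_expr; rewrite ger0_norm.
Qed.

Lemma pd_run_exists (R : realType) (n : nat) (F : 'rV[R]_n -> 'rV[R]_n)
    (K : 'rV[R]_n -> set 'rV[R]_n) (r : nat -> R) (x0 y0 : 'rV[R]_n) :
  (forall k, 0 < r k) ->
  (forall k x y, exists x' y', pd_step F K (r k) x y x' y') ->
  exists x y, pd_run F K r x0 y0 x y.
Proof.
move=> r0 step.
have /choice[next nextP] : forall s : nat * ('rV[R]_n * 'rV[R]_n),
    exists s', pd_step F K (r s.1) s.2.1 s.2.2 s'.1 s'.2.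
  by case=> k [x y]; have [x' [y' H]] := step k x y; exists (x', y').
pose st := nat_rect (fun=> 'rV[R]_n * 'rV[R]_n)%type (x0, y0)
  (fun k s => next (k, s)).
exists (fun k => (st k).1), (fun k => (st k).2).
by split=> // k; split=> //; exact: (nextP (k, st k)).
Qed.

Theorem theorem5p6 (R : realType) (n : nat)
    (F c : 'rV[R]_n -> 'rV[R]_n) (C : set 'rV[R]_n)
    (sigma lF lc tau : R)
    (sigma_gt0 : 0 < sigma) (F_mono : strongly_monotone sigma F)
    (lF_gt0 : 0 < lF) (F_lip : lipschitz_modulus lF F)
    (C_neq0 : C !=set0) (C_closed : closed C) (C_convex : convex_set C)
    (lc_gt0 : 0 < lc) (c_lip : lipschitz_modulus lc c)
    (tau_gt : 1 / 2 < tau) (tau_lt : tau < 1)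
    (modulus_gt0 : 0 < 2 * sigma - lF ^+ 2)
    (lc_le : lc <= (Num.sqrt tau - Num.sqrt 2 / 2) *
                   Num.sqrt (2 * sigma - lF ^+ 2)) :
  exists xb : 'rV[R]_n,
    [/\ QVI_solution F (moving_set c C) xb,
        forall z, QVI_solution F (moving_set c C) z -> z = xb &
        forall (x0 y0 : 'rV[R]_n) (r : nat -> R),
          0 < r 0%N ->
          (forall k,
             [/\ r 0%N <= r k, r k <= r k.+1 &
                 r k.+1 <= (1 / 2 - (Num.sqrt (2 * tau) - tau)) /
                           (1 / 2 + (Num.sqrt (2 * tau) - tau)) *
                           (2 * sigma - lF ^+ 2)]) ->
          (exists x y : nat -> 'rV[R]_n,
             pd_run F (moving_set c C) r x0 y0 x y) /\
          (forall x y : nat -> 'rV[R]_n,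
             pd_run F (moving_set c C) r x0 y0 x y ->
             [/\ x k @[k --> \oo] --> xb,
                 pd_merit xb r x y k @[k --> \oo] --> (0 : R) &
                 exists t : R, [/\ 0 < t, t < 1 &
                   forall k, pd_merit xb r x y k.+1 <=
                             t * pd_merit xb r x y k]])].
Proof.
set m := 2 * sigma - lF ^+ 2 in modulus_gt0 lc_le *.
set w := Num.sqrt (2 * tau).
have tau_gt0 : 0 < tau by lra.
have wE : w ^+ 2 = 2 * tau by rewrite sqr_sqrtr// mulr_ge0// ltW.
have w_ge0 : 0 <= w := sqrtr_ge0 _.
have w_gt1 : 1 < w by rewrite -ltr_sqr ?nnegrE// wE expr1n; lra.
(* In terms of w both hypotheses on the moduli become those of
   pd_step_contract, with the same constant (w - 1) ^+ 2 / 2. *)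
have aE : (w - 1) ^+ 2 / 2 = 1 / 2 - (w - tau).
  have -> : (w - 1) ^+ 2 = w ^+ 2 - 2 * w + 1 by ring.
  by rewrite wE; field.
have lc_sqr : lc ^+ 2 <= (w - 1) ^+ 2 / 2 * m.
  have -> : (w - 1) ^+ 2 / 2 * m =
      ((Num.sqrt tau - Num.sqrt 2 / 2) * Num.sqrt m) ^+ 2.
    rewrite exprMn sqr_sqrtr ?ltW// aE sqrrB expr_div_n !sqr_sqrtr ?ltW//.
    by rewrite /w sqrtrM ?ler0n//; field.
  have RHS_ge0 := le_trans (ltW lc_gt0) lc_le.
  by rewrite ler_sqr ?nnegrE// ltW.
have lc_lt : lc ^+ 2 < m.
  rewrite (le_lt_trans lc_sqr)// gtr_pMl// aE; lra.
have [xb [xbP xb_uniq]] := QVI_exists_unique sigma_gt0 F_mono lF_gt0 F_lip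
  C_neq0 C_closed C_convex c_lip lc_lt.
exists xb; split=> // x0 y0 r r0_gt0 rP.
have r_gt0 k : 0 < r k by have [r0k _ _] := rP k; exact: lt_le_trans r0k.
have r_le k : r k * (1 - (w - 1) ^+ 2 / 2) <= (w - 1) ^+ 2 / 2 * m.
  have := rP k => -[_ rkS]; rewrite -aE => /(le_trans rkS).
  have -> : 1 / 2 + (w - tau) = 1 - (w - 1) ^+ 2 / 2 by rewrite aE; lra.
  by rewrite mulrAC ler_pdivlMr// aE; lra.
split.
  apply: pd_run_exists => // k x y.
  have [xh Hxh] := prox_VI_exists c sigma_gt0 F_mono lF_gt0 F_lip C_neq0
    C_closed C_convex (x + (r k)^-1 *: y) (x - (r k)^-1 *: y) (ltW (r_gt0 k)).
  exists (2^-1 *: (xh + x - (r k)^-1 *: y)),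
         (y - (r k / 2) *: (xh - x + (r k)^-1 *: y)).
  by exists xh; split=> //; rewrite pd_mapE.
move=> x y [_ _ run].
have meritE k : pd_merit xb r x y k =
    dotp (x k - xb) (x k - xb) + (r k ^+ 2)^-1 * dotp (y k) (y k).
  by rewrite /pd_merit !enorm_sqr.
have merit_ge0 k : 0 <= pd_merit xb r x y k.
  by rewrite meritE addr_ge0 ?mulr_ge0 ?invr_ge0 ?sqr_ge0 ?dotp_ge0.
have merit_le k : pd_merit xb r x y k.+1 <= tau * pd_merit xb r x y k.
  have [_ step] := run k.
  have := pd_step_contract F_mono F_lip c_lip modulus_gt0 xbP w_gt1 lc_sqr
    (r_gt0 k) (r_le k) step.
  have -> : w ^+ 2 / 2 = tau by rewrite wE; field.
  rewrite !meritE; apply: le_trans; rewrite lerD2l ler_wpM2r ?dotp_ge0//.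
  have [_ rkS _] := rP k.
  have rkS2 : r k ^+ 2 <= r k.+1 ^+ 2 by rewrite ler_sqr ?nnegrE // ltW.
  by rewrite lef_pV2 ?posrE ?exprn_gt0.
have merit0 := linear_rate_cvg0 (ltW tau_gt0) tau_lt merit_ge0 merit_le.
split=> //; last by exists tau.
apply/cvgrPdist_lt => e e0.
have e20 : 0 < e ^+ 2 by rewrite exprn_gt0.
have /cvgrPdist_lt /(_ _ e20) := merit0.
apply: filterS => k; rewrite sub0r normrN ger0_norm// => Hk.
rewrite -ltr_sqr ?nnegrE ?(ltW e0)// distrC (le_lt_trans _ Hk)//.
rewrite (le_trans (norm_sqr_le_dotp _))// meritE lerDl.
by rewrite mulr_ge0 ?dotp_ge0 ?invr_ge0 ?sqr_ge0.
Qed.
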